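(* For all $\alpha,\beta\in\mathbb{C}$, $$\dim \mathrm{H}^1(\mathcal{W},\mathcal{F}_\alpha\otimes\mathcal{F}_\beta)=\begin{cases}5,&(\alpha,\beta)=(0,0);\\ 2,&(\alpha,\beta)=(0,1)\text{ or }(1,0);\\ 1,&(\alpha,\beta)\in\{(0,2),(2,0),(1,1)\}\text{ or }(\alpha+\beta=1,\ \beta\neq 0,1);\\ 0,&\text{otherwise.}\end{cases}$$
   Context: The Witt algebra $\mathcal{W}$ is the complex Lie algebra with basis $\{L_n\mid n\in\mathbb{Z}\}$ and bracket $[L_m,L_n]=(m-n)L_{m+n}$. For $\alpha\in\mathbb{C}$, the tensor density module $\mathcal{F}_\alpha$ has basis $\{v_n\mid n\in\mathbb{Z}\}$ with $L_m\cdot v_n=-(\alpha m+n)v_{m+n}$. The tensor product $\mathcal{F}_\alpha\otimes\mathcal{F}_\beta$ is a $\mathcal{W}$-module via $L_m\cdot(v_i\otimes v_j)=-(i+\alpha m)v_{m+i}\otimes v_j-(j+\beta m)v_i\otimes v_{m+j}$. For a Lie algebra $L$ and $L$-module $M$, $\mathrm{Der}(L,M)$ is the space of 1-cocycles (linear $d:L\to M$ with $d([x,y])=x\cdot d(y)-y\cdot d(x)$), $\mathrm{Inn}(L,M)$ the space of 1-coboundaries $d_v(x)=x\cdot v$ ($v\in M$), and $\mathrm{H}^1(L,M)=\mathrm{Der}(L,M)/\mathrm{Inn}(L,M)$. *)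

(* Defs.v *)
From HB Require Import structures.
From mathcomp Require Import all_boot all_order all_algebra.
From mathcomp Require Import reals complex.
Set Implicit Arguments. Unset Strict Implicit. Unset Printing Implicit Defensive.
Import Order.TTheory GRing.Theory Num.Theory.
Local Open Scope ring_scope.

(** Elements of M = F_alpha ⊗ F_beta are represented by their coefficient
    functions f : int -> int -> C, f i j = coefficient of v_i ⊗ v_j,
    subject to finite support. *)
Definition finsupp (C : zmodType) (f : int -> int -> C) : Prop :=
  exists N : nat, forall i j : int,
    (N%:Z < `|i| \/ N%:Z < `|j|) -> f i j = 0.

(** Action of L_m on an element f of F_alpha ⊗ F_beta:
    L_m (v_i ⊗ v_j) = -(i + alpha m) v_{m+i} ⊗ v_j - (j + beta m) v_i ⊗ v_{m+j},
    so the coefficient of v_a ⊗ v_b in L_m . f is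
    -((a - m) + alpha m) f(a-m, b) - ((b - m) + beta m) f(a, b-m). *)
Definition tact (C : nzRingType) (alpha beta : C) (m : int) (f : int -> int -> C)
  : int -> int -> C :=
  fun a b => - (((a - m)%:~R + alpha * m%:~R) * f (a - m) b)
             - (((b - m)%:~R + beta * m%:~R) * f a (b - m)).

(** A linear map d : W -> M is determined by the images d(L_n), n : int,
    which can be arbitrary elements of M.  It is a 1-cocycle (derivation)
    iff d([L_m, L_n]) = L_m . d(L_n) - L_n . d(L_m) for all basis elements,
    i.e. (m - n) d(L_{m+n}) = L_m . d(L_n) - L_n . d(L_m). *)
Definition is_der (C : nzRingType) (alpha beta : C) (d : int -> int -> int -> C) : Prop :=
  (forall n, finsupp (d n)) /\
  forall m n a b, (m - n)%:~R * d (m + n) a b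
                  = tact alpha beta m (d n) a b - tact alpha beta n (d m) a b.

Definition inner_der (C : nzRingType) (alpha beta : C) (v : int -> int -> C)
  : int -> int -> int -> C := fun m => tact alpha beta m v.

(** dim H^1(W, F_alpha ⊗ F_beta) = k : there are k derivations whose classes
    form a basis of the quotient Der / Inn, i.e. they span Der modulo Inn and
    are linearly independent modulo Inn. *)
Definition H1_dim_eq (C : nzRingType) (alpha beta : C) (k : nat) : Prop :=
  exists ds : 'I_k -> int -> int -> int -> C,
    (forall i, is_der alpha beta (ds i)) /\
    (forall D, is_der alpha beta D ->
       exists (c : 'I_k -> C) (v : int -> int -> C),
         finsupp v /\
         forall n a b, D n a b = \sum_(i < k) c i * ds i n a b
                                 + inner_der alpha beta v n a b) /\
    (forall (c : 'I_k -> C) (v : int -> int -> C), finsupp v ->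
       (forall n a b, \sum_(i < k) c i * ds i n a b = inner_der alpha beta v n a b) ->
       forall i, c i = 0).

(* Main.v *)
(** Subtracting a coboundary makes a cocycle homogeneous for [L_0], so that
    [d(L_n) = \sum_i d n i v_i (x) v_{n-i}].  Work first in the larger module of
    sums [\sum_i] infinite towards [i = +oo]: there [L_1] is a two-term recurrence
    with one possible obstruction (at [i = beta]), and the cocycle relations let
    one normalize [d(L_0) = d(L_1) = d(L_{-1}) = 0].  Then [d(L_2)] and [d(L_{-2})]
    are determined by their leading coefficients, at [i = alpha] and
    [i = beta - 2], and the relation between [L_2] and [L_{-2}] kills them except
    for (0,0), (0,1), (1,0), (0,2), (2,0), where the surviving classes come from
    [v_0 (x) F_beta] or [F_alpha (x) v_0].  A finite cocycle is therefore, up to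
    these, the coboundary of some [w] supported on [i >= N]; its tail satisfies
    the equations of an invariant, which forces it to be a multiple of [1]
    ([alpha + beta = 1]), [1/i] (for (0,0)), [i] (for (1,1)), or 0.  In the first
    three cases the coboundary of the half-infinite tail is finite and gives one
    more class. *)
Require Import Defs.
From HB Require Import structures.
From mathcomp Require Import all_boot all_order all_algebra.
From mathcomp Require Import reals complex.
From mathcomp Require Import boolp ring zify.
Import Order.TTheory GRing.Theory Num.Theory.
Local Open Scope ring_scope.

Set Implicit Arguments. Unset Strict Implicit.

(** * Degree-zero cochains and the enlarged module *)

Section Degree0.
Variables (C : numFieldType) (alpha beta : C).
Implicit Types (w : int -> C) (d : int -> int -> C) (m n i : int).

(* [w] stands for [\sum_i w i v_i (x) v_{n-i}], and [lact m n w i] is the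
   coefficient of [v_i (x) v_{m+n-i}] in its image under [L_m]. *)
Definition lact m n w i : C :=
  - (((i - m)%:~R + alpha * m%:~R) * w (i - m))
  - (((n - i)%:~R + beta * m%:~R) * w i).

Definition cob w n i : C := lact n 0 w i.

Definition cocycle d := forall m n i,
  (m - n)%:~R * d (m + n) i = lact m n (d n) i - lact n m (d m) i.

(** Membership in the enlarged module: sums infinite only towards [i = +oo]. *)
Definition bbelow w := exists N : int, forall i, i < N -> w i = 0.

Definition pcocycle d := cocycle d /\ forall n, bbelow (d n).

(** Serves as a linear-combination step: from a known [l = r], the goal [x = y] is left to
    [ring]. *)
Lemma eq_by (x y l r : C) : l = r -> @eq C (x - y) (l - r) -> x = y.
Proof. by move=> -> ; rewrite subrr => /subr0_eq. Qed.

(** The indices are variables tied by equations, so that numerical instances come with simplified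
    indices. *)
Lemma cocycleE d (m n k i i1 i2 : int) : cocycle d ->
    k = m + n -> i1 = i - m -> i2 = i - n ->
  (m - n)%:~R * d k i =
    - ((i1%:~R + alpha * m%:~R) * d n i1) - ((n - i)%:~R + beta * m%:~R) * d n i
    + (i2%:~R + alpha * n%:~R) * d m i2 + ((m - i)%:~R + beta * n%:~R) * d m i.
Proof. by move=> /(_ m n i) + -> -> -> => ->; rewrite /lact; ring. Qed.

Lemma bbelow0 : bbelow (fun=> 0).
Proof. by exists 0. Qed.

Lemma bbelow_lin (t : C) w1 w2 :
  bbelow w1 -> bbelow w2 -> bbelow (fun i => w1 i + t * w2 i).
Proof.
move=> [N1 h1] [N2 h2]; exists (Num.min N1 N2) => i.
by rewrite lt_min => /andP[/h1 -> /h2 ->]; rewrite mulr0 addr0.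
Qed.

Lemma bbelow_lact m n w : bbelow w -> bbelow (lact m n w).
Proof.
move=> [N h]; exists (N - `|m|) => i hi.
by rewrite /lact !h ?mulr0 ?subr0 ?oppr0 //; lia.
Qed.

Lemma lact_lin m n (t : C) w1 w2 i :
  lact m n (fun i => w1 i + t * w2 i) i = lact m n w1 i + t * lact m n w2 i.
Proof. by rewrite /lact; ring. Qed.

Lemma cocycle_lin (t : C) d1 d2 : cocycle d1 -> cocycle d2 ->
  cocycle (fun n i => d1 n i + t * d2 n i).
Proof.
by move=> h1 h2 m n i; rewrite !lact_lin mulrDr mulrCA h1 h2; ring.
Qed.

Lemma cob_cocycle w : cocycle (cob w).
Proof.
move=> m n i; rewrite /cob /lact.
have -> : i - n - m = i - (m + n) by ring.
have -> : i - m - n = i - (m + n) by ring.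
by ring.
Qed.

Lemma pcocycle_cob w : bbelow w -> pcocycle (cob w).
Proof. by move=> h; split=> [|n]; [exact: cob_cocycle | exact: bbelow_lact]. Qed.

Lemma pcocycle_lin (t : C) d1 d2 : pcocycle d1 -> pcocycle d2 ->
  pcocycle (fun n i => d1 n i + t * d2 n i).
Proof.
move=> [h1 b1] [h2 b2]; split=> [|n]; first exact: cocycle_lin.
exact: bbelow_lin.
Qed.

(** * Two-term recurrences on bounded-below sequences *)

Lemma int_ind_from (N : int) (P : int -> Prop) :
  (forall i, i < N -> P i) -> (forall i, P (i - 1) -> P i) -> forall i, P i.
Proof.
move=> h0 hS i; have [/h0 //|hi] := ltP i N.
have -> : i = N + absz (i - N)%R by lia.
elim: (absz (i - N)%R) => [|k IH].
  by apply: hS; apply: h0; lia.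
by apply: hS; rewrite (_ : N + k.+1 - 1 = N + k) //; lia.
Qed.

(** Zeros at [-oo] propagate upwards as long as the leading coefficient [p] does not vanish. *)
Lemma bbelow_zero w (p q : int -> C) (J : int) : bbelow w ->
    (forall i, i < J -> p i != 0) ->
    (forall i, i < J -> p i * w i = q i * w (i - 1)) ->
  forall i, i < J -> w i = 0.
Proof.
move=> [N hN] hp hw; apply: (@int_ind_from N) => [i /hN //|i IH iJ].
have := hw i iJ; rewrite IH ?mulr0; last by lia.
by move/eqP; rewrite mulf_eq0 (negPf (hp i iJ)) /= => /eqP.
Qed.

Lemma bbelow_zero_except w (p q : int -> C) : bbelow w ->
    (forall i, p i * w i = q i * w (i - 1)) ->
    (forall i, p i = 0 -> w i = 0) ->
  forall i, w i = 0.
Proof.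
move=> [N hN] hw h0; apply: (@int_ind_from N) => // i IH.
have [/h0 //|pi] := eqVneq (p i) 0.
by apply: (mulfI pi); rewrite hw IH !mulr0.
Qed.

Lemma bbelow_first w i : bbelow w -> w i != 0 ->
  exists2 i0 : int, w i0 != 0 & forall j : int, j < i0 -> w j = 0.
Proof.
move=> [N hN] wi; apply: contrapT => hne.
suff hz : forall j k, k <= j -> w k = 0.
  by rewrite (hz i i) ?eqxx in wi.
apply: (@int_ind_from N) => [j hj k kj|j IH k]; first by apply: hN; lia.
rewrite le_eqVlt => /orP[/eqP ->|kj]; last by apply: IH; lia.
apply/eqP/negPn/negP => wj; apply: hne; exists j => // l lj.
by apply: IH; lia.
Qed.

(** Upward recursion from [N]; at a root of [p] the equation is given up and the free value [t] is
    taken. *)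
Lemma solve_from (p q f : int -> C) (N : int) (t : C) :
  exists w, [/\ forall i, i < N -> w i = 0,
    forall i, N <= i -> p i != 0 -> p i * w i = q i * w (i - 1) + f i
  & forall i, N <= i -> p i = 0 -> w i = t].
Proof.
pose step (i : int) (y : C) := if p i == 0 then t else (q i * y + f i) / p i.
pose u := fix u k := step (N + k%:Z) (if k is k'.+1 then u k' else 0).
pose w i := if i < N then 0 else u (absz (i - N)%R).
have wE i : N <= i -> w i = step i (w (i - 1)).
  move=> Ni; rewrite {1}/w ltNge Ni /=; have [k ->] : exists k : nat, i = N + k.
    by exists (absz (i - N)%R); lia.
  have -> : absz (N + k - N)%R = k by lia.
  case: k => [|k] /=; rewrite /w.
    by have -> : N + 0%N - 1 < N = true by lia.
  have -> : N + k.+1 - 1 < N = false by lia.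
  by have -> : absz (N + k.+1 - 1 - N)%R = k by lia.
exists w; split=> [i iN|i Ni pi|i Ni pi].
- by rewrite /w iN.
- by rewrite wE // /step (negPf pi) mulrC divfK.
- by rewrite wE // /step pi eqxx.
Qed.

Lemma intrB_eq0 (m n : int) : (m%:~R - n%:~R == 0 :> C) = (m == n).
Proof. by rewrite subr_eq0 eqr_int. Qed.

(** At the lowest index [i0] of the support, [L_1] gives [beta = i0] and [L_2] gives [2 beta = i0],
    so both are 0. Then [L_{-1}] gives [alpha = 0], and [L_1] kills the coefficients at positive
    indices one after another. *)
Lemma invariant_supp w i : bbelow w -> (forall m i, lact m 0 w i = 0) ->
  w i != 0 -> [/\ alpha = 0, beta = 0 & i = 0].
Proof.
move=> bw inv wi; have [i0 w0 lt0] := bbelow_first bw wi.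
have h1 : beta - i0%:~R = 0.
  apply: (mulIf w0); rewrite mul0r; apply: (eq_by (esym (inv 1 i0))).
  by rewrite /lact (lt0 (i0 - 1)) ?mulr0; [ring | lia].
have h2 : beta * 2 - i0%:~R = 0.
  apply: (mulIf w0); rewrite mul0r; apply: (eq_by (esym (inv 2 i0))).
  by rewrite /lact (lt0 (i0 - 2)) ?mulr0; [ring | lia].
have bE : beta = i0%:~R by apply: (eq_by h1); ring.
have i00 : i0 = 0.
  have /eqP : i0%:~R = 0 :> C by apply: (eq_by h2); rewrite bE; ring.
  by rewrite intr_eq0 => /eqP.
have b0 : beta = 0 by rewrite bE i00.
have a0 : alpha = 0.
  apply: (mulIf w0); rewrite mul0r; apply: (eq_by (inv (-1) (i0 - 1))).
  rewrite /lact (lt0 (i0 - 1)) ?mulr0; last by lia.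
  by have -> : i0 - 1 - -1 = i0 by [lia]; rewrite i00; ring.
split=> //; move: wi; have [i_lt0|i_gt0|//] := ltgtP i 0.
  by rewrite lt0 ?eqxx // i00.
move=> /eqP[]; rewrite (_ : i = 1 + absz (i - 1)%R); last by lia.
elim: (absz (i - 1)%R) => [|k IH].
  by rewrite addr0; apply: (eq_by (inv 1 1)); rewrite /lact a0 b0 subrr; ring.
have hk : ((1 + k.+1%:Z)%:~R : C) != 0 by rewrite intr_eq0; lia.
apply: (mulfI hk); apply: (eq_by (inv 1 (1 + k.+1%:Z))).
rewrite /lact a0 b0 (_ : 1 + k.+1%:Z - 1 = 1 + k); last by lia.
by rewrite IH; ring.
Qed.


(** * Cohomology in the enlarged module and normalization *)

Definition cohom d e :=
  exists2 w, bbelow w & forall n i, d n i = e n i + cob w n i.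

Lemma cohom_trans d1 d2 d3 : cohom d1 d2 -> cohom d2 d3 -> cohom d1 d3.
Proof.
move=> [w bw h1] [v bv h2]; exists (fun i => v i + 1 * w i).
  exact: bbelow_lin.
by move=> n i; rewrite h1 h2 /cob lact_lin; ring.
Qed.

Lemma cohom_cob (t : C) d w : bbelow w ->
  cohom d (fun n i => d n i + t * cob w n i).
Proof.
move=> bw; exists (fun i => 0 + (- t) * w i).
  exact: (bbelow_lin (- t) bbelow0 bw).
by move=> n i; rewrite /cob lact_lin /lact; ring.
Qed.

(** [L_0] acts on degree [m] as [-m], so the relation of [L_m] with [L_0] reduces to
    [L_m d(L_0) = 0]. *)
Lemma invariant0 d : pcocycle d -> forall m i, lact m 0 (d 0) i = 0.
Proof.
move=> [hd _] m i; apply: (eq_by (esym (hd m 0 i))).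
by rewrite /lact addr0 !subr0; ring.
Qed.

(** Solving upwards for a primitive of [d 1] fails only where the leading coefficient [i - beta] is
    zero. *)
Lemma L1_reduce d : pcocycle d ->
  exists2 w, bbelow w & forall i, i%:~R != beta -> d 1 i = cob w 1 i.
Proof.
move=> [hd /(_ 1) [N hN]].
have [w [w0 w1 _]] := solve_from (fun i => i%:~R - beta)
  (fun i => i%:~R - 1 + alpha) (d 1) N 0.
exists w => [|i ib]; first by exists N.
have [iN|Ni] := ltP i N.
  by rewrite hN // /cob /lact !w0; [ring | lia | lia].
by apply: (eq_by (esym (w1 i Ni _))); rewrite ?subr_eq0 // /cob /lact; ring.
Qed.

(** The homogeneous recurrence can start at [i = b] because its leading coefficient vanishes
    there. *)
Lemma L1_kernel (b : int) : beta = b%:~R -> exists w,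
  [/\ forall i, i < b -> w i = 0, w b = 1 & forall i, lact 1 0 w i = 0].
Proof.
move=> bE.
have [w [w0 w1 wt]] := solve_from (fun i => i%:~R - beta)
  (fun i => i%:~R - 1 + alpha) (fun=> 0) b 1.
have wb : w b = 1 by rewrite wt // bE subrr.
exists w; split=> // i; have [ib|bi|->] := ltgtP i b.
- by rewrite /lact !w0; [ring | lia | lia].
- have pi : i%:~R - beta != 0 by rewrite bE intrB_eq0; lia.
  by apply: (eq_by (w1 i (ltW bi) pi)); rewrite /lact; ring.
- by rewrite /lact w0 ?wb ?bE; [ring | lia].
Qed.

Definition normalized d := forall i, [/\ d 0 i = 0, d 1 i = 0 & d (-1) i = 0].

(** Once [d 0 = d 1 = 0], the relation of [L_1] and [L_{-1}] is a recurrence for [d (-1)] with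
    leading coefficient [i + 1 - beta]; only its root has to be checked. *)
Lemma normalized_of_zero d : pcocycle d ->
    (forall i, d 0 i = 0) -> (forall i, d 1 i = 0) ->
    (forall i, (i + 1)%:~R = beta -> d (-1) i = 0) ->
  normalized d.
Proof.
move=> [hd bd] d0 d1 dm; suff z i : d (-1) i = 0 by move=> i.
apply: (bbelow_zero_except (p := fun i => (i + 1)%:~R - beta)
  (q := fun i => i%:~R - 1 + alpha) (bd _)) => [j|j /subr0_eq /dm //].
have E := cocycleE (m:=1) (n:=-1) (k:=0) (i:=j) (i1:=j-1) (i2:=j+1) hd
  ltac:(lia) ltac:(lia) ltac:(lia).
by apply: (eq_by (esym E)); rewrite d0 !d1; ring.
Qed.

Lemma dm1_below (b : int) d : beta = b%:~R -> pcocycle d ->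
    (forall i, d 0 i = 0) -> (forall i, i != b -> d 1 i = 0) ->
  forall i, i < b - 1 -> d (-1) i = 0.
Proof.
move=> bE [hd bd] d0 d1.
apply: (bbelow_zero (p := fun i => (i + 1)%:~R - beta)
  (q := fun i => i%:~R - 1 + alpha) (bd _)) => j jb.
  by rewrite bE intrB_eq0; lia.
have E := cocycleE (m:=1) (n:=-1) (k:=0) (i:=j) (i1:=j-1) (i2:=j+1) hd
  ltac:(lia) ltac:(lia) ltac:(lia).
by apply: (eq_by (esym E)); rewrite d0 !d1; [ring | lia | lia].
Qed.

(* For [alpha = beta] the (1,-1) relation gives no information on [d(L_1)_b];
   the (-1,2) and (1,-2) relations are used instead. *)
Lemma normalized_diag (b : int) d : beta = b%:~R -> alpha = beta -> beta != 0 ->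
    pcocycle d -> (forall i, d 0 i = 0) -> (forall i, i != b -> d 1 i = 0) ->
  normalized d.
Proof.
move=> bE ab b0 pd d0 d1; have [hd bd] := pd.
have dm := dm1_below bE pd d0 d1.
have d2 i : i < b -> d 2 i = 0.
  move: i; apply: (bbelow_zero (p := fun i => i%:~R - alpha)
    (q := fun i => i%:~R - 3 + beta) (bd _)) => j jb.
    by rewrite ab bE intrB_eq0; lia.
  have E := cocycleE (m:=-1) (n:=2) (k:=1) (i:=j-1) (i1:=j) (i2:=j-3) hd
    ltac:(lia) ltac:(lia) ltac:(lia).
  by apply: (eq_by E); rewrite d1 ?(dm (j - 3)) ?(dm (j - 1)); [ring | lia..].
(* At [i = b - 1] the coefficient [b - alpha] of [d 2 b] is zero, which isolates
   [beta * d (-1) (b - 1)]. *)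
have x0 : d (-1) (b - 1) = 0.
  have E := cocycleE (m:=-1) (n:=2) (k:=1) (i:=b-1) (i1:=b) (i2:=b-3) hd
    ltac:(lia) ltac:(lia) ltac:(lia).
  apply: (mulfI b0); apply: (eq_by (esym E)).
  by rewrite d1 ?(dm (b - 3)) ?(d2 (b - 1)) ?ab ?bE; [ring | lia..].
have dm2 i : i < b - 2 -> d (-2) i = 0.
  move: i; apply: (bbelow_zero (p := fun i => (i + 2)%:~R - beta)
    (q := fun i => i%:~R - 1 + alpha) (bd _)) => j jb.
    by rewrite bE intrB_eq0; lia.
  have E := cocycleE (m:=1) (n:=-2) (k:=-1) (i:=j) (i1:=j-1) (i2:=j+2) hd
    ltac:(lia) ltac:(lia) ltac:(lia).
  by apply: (eq_by (esym E)); rewrite !d1 ?(dm j); [ring | lia..].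
(* At [i = b - 2] the term in [d (-2) (b - 2)] drops out in the same way, which isolates
   [beta * d 1 b]. *)
have c0 : d 1 b = 0.
  have E := cocycleE (m:=1) (n:=-2) (k:=-1) (i:=b-2) (i1:=b-3) (i2:=b) hd
    ltac:(lia) ltac:(lia) ltac:(lia).
  apply: (mulfI b0); apply: (eq_by E).
  by rewrite (d1 (b - 2)) ?(dm (b - 2)) ?(dm2 (b - 3)) ?ab ?bE; [ring | lia..].
apply: normalized_of_zero => // i; first by have [->//|/d1] := eqVneq i b.
by rewrite bE => /intr_inj ib; rewrite (_ : i = b - 1) //; lia.
Qed.

(* The relation at [i = b - 1] gives [(b - alpha) d(L_1)_b = 0]; the remaining
   parameter [d(L_{-1})_{b-1}] is absorbed by the bounded-below kernel of [L_1]. *)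
Lemma normalize_off_diag (b : int) d : beta = b%:~R -> alpha != beta ->
    pcocycle d -> (forall i, d 0 i = 0) -> (forall i, i != b -> d 1 i = 0) ->
  exists e, [/\ pcocycle e, normalized e & cohom d e].
Proof.
move=> bE ab pd d0 d1; have [hd bd] := pd.
have dm := dm1_below bE pd d0 d1.
have ba0 : beta - alpha != 0 by rewrite subr_eq0 eq_sym.
have c0 : d 1 b = 0.
  have E := cocycleE (m:=1) (n:=-1) (k:=0) (i:=b-1) (i1:=b-2) (i2:=b) hd
    ltac:(lia) ltac:(lia) ltac:(lia).
  apply: (mulfI ba0); apply: (eq_by (esym E)).
  by rewrite d0 (d1 (b - 1)) ?(dm (b - 2)) ?bE; [ring | lia..].
have d10 i : d 1 i = 0 by have [->//|/d1] := eqVneq i b.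
have [w [w0 wb wE]] := L1_kernel bE.
have bw : bbelow w by exists b.
pose t := d (-1) (b - 1) / (beta - alpha).
exists (fun n i => d n i + t * cob w n i); split; last exact: cohom_cob.
  by apply: pcocycle_lin => //; exact: pcocycle_cob.
apply: normalized_of_zero => [|i|i|i ib].
- by apply: pcocycle_lin => //; exact: pcocycle_cob.
- by rewrite d0 /cob /lact !subr0; ring.
- by rewrite d10 /cob wE; ring.
have -> : i = b - 1 by move: ib; rewrite bE => /intr_inj; lia.
have -> : cob w (-1) (b - 1) = - (beta - alpha).
  rewrite /cob /lact (_ : b - 1 - -1 = b); last by lia.
  by rewrite wb (w0 (b - 1)) ?bE; [ring | lia].
by rewrite mulrN divfK ?subrr.
Qed.

Lemma cohom_refl d : cohom d d.
Proof.
exists (fun=> 0) => [|n i]; first exact: bbelow0.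
by rewrite /cob /lact; ring.
Qed.

(** Without nonzero invariants [d 0] vanishes, and a coboundary clears [d 1] away from [i = beta].
    Something is left to do only when [beta] is an integer; the cases [alpha = beta] and
    [alpha != beta] then differ. *)
Lemma normalize d : pcocycle d -> ~ (alpha = 0 /\ beta = 0) ->
  exists e, [/\ pcocycle e, normalized e & cohom d e].
Proof.
move=> pd ab0; have [w bw wE] := L1_reduce pd.
pose e n i := d n i + (-1) * cob w n i.
have pe : pcocycle e by apply: pcocycle_lin => //; exact: pcocycle_cob.
have de : cohom d e by exact: cohom_cob.
have e1 i : i%:~R != beta -> e 1 i = 0 by move=> ib; rewrite /e wE //; ring.
have e0 i : e 0 i = 0.
  apply/eqP/negPn/negP => ei.
  by have [] := invariant_supp (pe.2 0) (invariant0 pe) ei => a0 b0 _; apply: ab0.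
have [[b bE]|nb] := pselect (exists b : int, beta = b%:~R); last first.
  exists e; split=> //; apply: normalized_of_zero => // i.
    by apply: e1; apply/negP => /eqP ib; apply: nb; exists i.
  by move=> ib; case: nb; exists (i + 1).
have e1b i : i != b -> e 1 i = 0.
  by move=> ib; apply: e1; rewrite bE eqr_int.
have [e' [pe' ne' ee']] : exists e', [/\ pcocycle e', normalized e' & cohom e e'].
  have [ab|ab] := eqVneq alpha beta.
    exists e; split=> //; last by exact: cohom_refl.
    apply: (normalized_diag bE) => //.
    by apply/eqP => b0; apply: ab0; rewrite ab.
  exact: (normalize_off_diag bE).
by exists e'; split=> //; exact: cohom_trans ee'.
Qed.

(** * Normalized cocycles, controlled by [d 2] and [d (-2)] *)

Lemma normalized_rec2 d : pcocycle d -> normalized d -> forall i,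
  (i%:~R - alpha) * d 2 i = (i%:~R - 3 + beta) * d 2 (i - 1).
Proof.
move=> [hd _] nd i.
have E := cocycleE (m:=-1) (n:=2) (k:=1) (i:=i-1) (i1:=i) (i2:=i-3) hd
  ltac:(lia) ltac:(lia) ltac:(lia).
have [_ z1 _] := nd (i - 1); have [_ _ z2] := nd (i - 1); have [_ _ z3] := nd (i - 3).
by apply: (eq_by E); rewrite z1 z2 z3; ring.
Qed.

Lemma normalized_recm2 d : pcocycle d -> normalized d -> forall i,
  ((i + 2)%:~R - beta) * d (-2) i = (i%:~R - 1 + alpha) * d (-2) (i - 1).
Proof.
move=> [hd _] nd i.
have E := cocycleE (m:=1) (n:=-2) (k:=-1) (i:=i) (i1:=i-1) (i2:=i+2) hd
  ltac:(lia) ltac:(lia) ltac:(lia).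
have [_ z1 z2] := nd i; have [_ z3 _] := nd (i + 2).
by apply: (eq_by (esym E)); rewrite z1 z2 z3; ring.
Qed.

Lemma normalized_rel4 d : pcocycle d -> normalized d -> forall i,
  (i%:~R - 2 + alpha * 2) * d (-2) (i - 2) - (2 + i%:~R - beta * 2) * d (-2) i
  = (i%:~R + 2 - alpha * 2) * d 2 (i + 2) - (i%:~R - 2 + beta * 2) * d 2 i.
Proof.
move=> [hd _] nd i.
have E := cocycleE (m:=2) (n:=-2) (k:=0) (i:=i) (i1:=i-2) (i2:=i+2) hd
  ltac:(lia) ltac:(lia) ltac:(lia).
have [z0 _ _] := nd i.
by apply: (eq_by E); rewrite z0; ring.
Qed.

(** [[L_1, L_k]] is a nonzero multiple of [L_{k+1}] for [k >= 2], and likewise with negative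
    indices, so vanishing spreads from [L_{-2}, ..., L_2] to all [L_n]. *)
Lemma normalized_zero d : pcocycle d -> normalized d ->
  (forall i, d 2 i = 0) -> (forall i, d (-2) i = 0) -> forall n i, d n i = 0.
Proof.
move=> [hd _] nd z2 zm2.
have pos (k : nat) i : d (k.+2)%:Z i = 0.
  elim: k i => [//|k IH] i.
  have E := cocycleE (m:=1) (n:=k.+2) (k:=k.+3) (i:=i) (i1:=i-1) (i2:=i-k.+2%:Z) hd
    ltac:(lia) ltac:(lia) ltac:(lia).
  have k0 : (1 - k.+2%:Z)%:~R != 0 :> C by rewrite intr_eq0; lia.
  apply: (mulfI k0); rewrite E !IH.
  have [_ -> _] := nd (i - k.+2%:Z); have [_ -> _] := nd i; ring.
have neg (k : nat) i : d (- k.+2%:Z) i = 0.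
  elim: k i => [//|k IH] i.
  have E := cocycleE (m:=-1) (n:=-k.+2%:Z) (k:=-k.+3%:Z) (i:=i) (i1:=i+1)
    (i2:=i+k.+2%:Z) hd ltac:(lia) ltac:(lia) ltac:(lia).
  have k0 : (-1 + k.+2%:Z)%:~R != 0 :> C by rewrite intr_eq0; lia.
  rewrite opprK in E; apply: (mulfI k0); rewrite E !IH.
  have [_ _ ->] := nd (i + k.+2%:Z); have [_ _ ->] := nd i; ring.
move=> [[|[|n]]|[|n]] i; have [h0 h1 hm1] := nd i.
- exact: h0.
- exact: h1.
- exact: pos.
- exact: hm1.
- by rewrite NegzE; exact: neg.
Qed.

(** The hypothesis removes the only free coefficient of [d 2]. If [d (-2)] survives, it starts at
    [i = beta - 2]; there the relation of [L_2] and [L_{-2}] forces [beta = 0], and at [i = -1] it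
    forces [alpha = 2]. *)
Lemma normalized_zero_of_d2 d : pcocycle d -> normalized d ->
    ~ (alpha = 2 /\ beta = 0) -> (forall i, i%:~R = alpha -> d 2 i = 0) ->
  forall n i, d n i = 0.
Proof.
move=> pd nd hab z.
have rm2 := normalized_recm2 pd nd; have r2 := normalized_rec2 pd nd.
have r4 := normalized_rel4 pd nd.
have z2 : forall i, d 2 i = 0.
  by apply: (bbelow_zero_except (pd.2 2) r2) => i /subr0_eq; exact: z.
apply: normalized_zero => //; apply: (bbelow_zero_except (pd.2 (-2)) rm2) => i.
move=> /subr0_eq ib; apply/eqP/negPn/negP => q0.
have below j : j < i -> d (-2) j = 0.
  move: j; apply: (bbelow_zero (pd.2 (-2)) (p := fun j => (j + 2)%:~R - beta)) => [j ji|j _].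
    by rewrite -ib intrB_eq0; lia.
  exact: rm2.
have b0 : beta = 0.
  apply: (mulIf q0); rewrite mul0r; apply: (eq_by (r4 i)).
  by rewrite !z2 (below (i - 2)) -?ib; [ring | lia].
apply: hab; split=> //; rewrite b0 in ib.
have i2 : i = -2 by move/eqP: ib; rewrite intr_eq0 => /eqP; lia.
have e1 : d (-2) (-1) = (alpha - 2) * d (-2) (-2).
  by apply: (eq_by (rm2 (-1))); rewrite b0; ring.
have e2 : d (-2) (-1) = 0.
  apply: (eq_by (esym (r4 (-1)))).
  by rewrite !z2 (below (-1 - 2)) ?b0; [ring | lia].
rewrite i2 in q0; move: e1; rewrite e2 => /esym/eqP.
rewrite mulf_eq0 (negPf q0) orbF.
by rewrite subr_eq0 => /eqP.
Qed.

(** The mirror argument: a surviving [d 2] starts at [i = alpha], which forces [alpha = 0] and then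
    [beta = 2]. *)
Lemma normalized_zero_of_dm2 d : pcocycle d -> normalized d ->
    ~ (alpha = 0 /\ beta = 2) -> (forall i, (i + 2)%:~R = beta -> d (-2) i = 0) ->
  forall n i, d n i = 0.
Proof.
move=> pd nd hab z.
have rm2 := normalized_recm2 pd nd; have r2 := normalized_rec2 pd nd.
have r4 := normalized_rel4 pd nd.
have z2 : forall i, d (-2) i = 0.
  by apply: (bbelow_zero_except (pd.2 (-2)) rm2) => i /subr0_eq; exact: z.
apply: normalized_zero => //; apply: (bbelow_zero_except (pd.2 2) r2) => i.
move=> /subr0_eq ia; apply/eqP/negPn/negP => p0.
have below j : j < i -> d 2 j = 0.
  move: j; apply: (bbelow_zero (pd.2 2) (p := fun j => j%:~R - alpha)) => [j ji|j _].
    by rewrite -ia intrB_eq0; lia.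
  exact: r2.
have a0 : alpha = 0.
  apply: (mulIf p0); rewrite mul0r; apply: (eq_by (r4 (i - 2))).
  by rewrite !z2 (below (i - 2)) ?subrK -?ia; [ring | lia].
apply: hab; split=> //; rewrite a0 in ia.
have i0 : i = 0 by move/eqP: ia; rewrite intr_eq0 => /eqP.
have e1 : d 2 1 = (beta - 2) * d 2 0.
  by apply: (eq_by (r2 1)); rewrite a0; ring.
have e2 : d 2 1 = 0.
  apply: (eq_by (esym (r4 (-1)))).
  by rewrite !z2 (below (-1)) ?a0; [ring | lia].
rewrite i0 in p0; move: e1; rewrite e2 => /esym/eqP.
rewrite mulf_eq0 (negPf p0) orbF.
by rewrite subr_eq0 => /eqP.
Qed.

(** For integers [alpha = a < b = beta], [d 2] vanishes below [a] and [d (-2)] below [b - 2], so the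
    relation of [L_2] and [L_{-2}] at [a - 2] amounts to [alpha * d 2 a = 0]. If [alpha = 0], its
    instance at [-1] gives [d 2 1 = 0], while [d 2 1 = (beta - 2) * d 2 0]. For [b < a] the roles of
    [d 2] and [d (-2)] are exchanged. *)
Lemma normalized_zero_off_diag d : pcocycle d -> normalized d -> alpha != beta ->
    ~ (alpha = 0 /\ beta = 1) -> ~ (alpha = 1 /\ beta = 0) ->
    ~ (alpha = 0 /\ beta = 2) -> ~ (alpha = 2 /\ beta = 0) ->
  forall n i, d n i = 0.
Proof.
move=> pd nd ab n01 n10 n02 n20.
have rm2 := normalized_recm2 pd nd; have r2 := normalized_rec2 pd nd.
have r4 := normalized_rel4 pd nd.
have [[a aE]|na] := pselect (exists a : int, alpha = a%:~R); last first.
  by apply: normalized_zero_of_d2 => // i ia; case: na; exists i.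
have [[b bE]|nb] := pselect (exists b : int, beta = b%:~R); last first.
  by apply: normalized_zero_of_dm2 => // i ib; case: nb; exists (i + 2).
have belowa j : j < a -> d 2 j = 0.
  move: j; apply: (bbelow_zero (pd.2 2) (p := fun j => j%:~R - alpha)) => [j ji|j _].
    by rewrite aE intrB_eq0; lia.
  exact: r2.
have belowb j : j < b - 2 -> d (-2) j = 0.
  move: j; apply: (bbelow_zero (pd.2 (-2)) (p := fun j => (j + 2)%:~R - beta)) => [j ji|j _].
    by rewrite bE intrB_eq0; lia.
  exact: rm2.
have eqC (m n : int) : m%:~R = n%:~R :> C <-> m = n by split=> [/intr_inj|->].
move: ab; rewrite aE bE eqr_int neq_lt => /orP[ab|ba].
  apply: normalized_zero_of_d2 => // i; rewrite aE => /intr_inj ->.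
  have [a0|a0] := eqVneq alpha 0; last first.
    apply: (mulfI a0); apply: (eq_by (r4 (a - 2))).
    by rewrite subrK (belowa (a - 2)) ?(belowb (a - 2 - 2)) ?(belowb (a - 2)) ?aE; [ring | lia..].
  have az : a = 0 by apply/eqC; rewrite -aE a0.
  have b1 : b != 1 by apply/eqP => b1; apply: n01; rewrite bE b1.
  have b2 : b != 2 by apply/eqP => b2; apply: n02; rewrite bE b2.
  have s0 : beta - 2 != 0 by rewrite bE (intrB_eq0 b 2).
  subst a; apply: (mulfI s0); rewrite mulr0.
  have <- : d 2 1 = (beta - 2) * d 2 0.
    by apply: (eq_by (r2 1)); rewrite a0; ring.
  apply: (eq_by (esym (r4 (-1)))).
  by rewrite (belowa (-1)) ?(belowb (-1 - 2)) ?(belowb (-1)) ?a0; [ring | lia..].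
apply: normalized_zero_of_dm2 => // i; rewrite bE => /intr_inj ib.
have {ib}-> : i = b - 2 by lia.
have [b0|b0] := eqVneq beta 0; last first.
  apply: (mulfI b0); apply: (eq_by (r4 (b - 2))).
  by rewrite subrK (belowb (b - 2 - 2)) ?(belowa (b - 2)) ?(belowa b) ?bE; [ring | lia..].
have bz : b = 0 by apply/eqC; rewrite -bE b0.
have a1 : a != 1 by apply/eqP => a1; apply: n10; rewrite aE a1.
have a2 : a != 2 by apply/eqP => a2; apply: n20; rewrite aE a2.
have s0 : alpha - 2 != 0 by rewrite aE (intrB_eq0 a 2).
subst b; apply: (mulfI s0); rewrite mulr0.
have <- : d (-2) (-1) = (alpha - 2) * d (-2) (0 - 2).
  by apply: (eq_by (rm2 (-1))); rewrite b0; ring.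
apply: (eq_by (esym (r4 (-1)))).
by rewrite (belowa (-1)) ?(belowa (-1+2)) ?(belowb (-1 - 2)) ?b0; [ring | lia..].
Qed.

Lemma normalized_lin (t : C) d1 d2 : normalized d1 -> normalized d2 ->
  normalized (fun n i => d1 n i + t * d2 n i).
Proof. by move=> h1 h2 i; have [-> -> ->] := h1 i; have [-> -> ->] := h2 i; split; ring. Qed.

Lemma cohom_lin (t : C) d1 d2 e1 e2 : cohom d1 e1 -> cohom d2 e2 ->
  cohom (fun n i => d1 n i + t * d2 n i) (fun n i => e1 n i + t * e2 n i).
Proof.
move=> [w bw h1] [v bv h2]; exists (fun i => w i + t * v i).
  exact: bbelow_lin.
by move=> n i; rewrite h1 h2 /cob lact_lin; ring.
Qed.

Lemma cohom_zero d : (forall n i, d n i = 0) -> cohom d (fun _ _ => 0).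
Proof.
move=> z; exists (fun=> 0); first exact: bbelow0.
by move=> n i; rewrite z /cob /lact; ring.
Qed.

(* For [alpha = beta] the bounded-below kernel of [L_1] in degree 0 is
   [sl_2]-invariant but not [L_2]-invariant, so it can be used to change [d 2 a]. *)
Lemma normalized_kill_diag (a : int) d : alpha = a%:~R -> alpha = beta ->
    alpha != 0 -> pcocycle d -> normalized d ->
  exists e, [/\ pcocycle e, normalized e, cohom d e & e 2 a = 0].
Proof.
move=> aE ab a0 pd nd; have bE : beta = a%:~R by rewrite -ab.
have [w [w0 wa wE]] := L1_kernel bE.
have bw : bbelow w by exists a.
pose t := d 2 a / alpha.
exists (fun n i => d n i + t * cob w n i); split.
- by apply: pcocycle_lin => //; exact: pcocycle_cob.
- apply: normalized_lin => //; apply: normalized_of_zero => [|i|i|i ia].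
  + exact: pcocycle_cob.
  + by rewrite /cob /lact !subr0; ring.
  + by rewrite /cob wE.
  + have -> : i = a - 1 by move: ia; rewrite bE => /intr_inj; lia.
    rewrite /cob /lact (_ : a - 1 - -1 = a); last by lia.
    by rewrite wa (w0 (a - 1)) ?aE; [ring | lia].
- exact: cohom_cob.
- have -> : cob w 2 a = - alpha.
    by rewrite /cob /lact wa (w0 (a - 2)) -?ab ?aE; [ring | lia].
  by rewrite mulrN divfK ?subrr.
Qed.

Lemma cohom_trivial d : pcocycle d ->
    ~ (alpha = 0 /\ beta = 0) ->
    ~ (alpha = 0 /\ beta = 1) -> ~ (alpha = 1 /\ beta = 0) ->
    ~ (alpha = 0 /\ beta = 2) -> ~ (alpha = 2 /\ beta = 0) ->
  cohom d (fun _ _ => 0).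
Proof.
move=> pd n00 n01 n10 n02 n20.
have [e [pe ne de]] := normalize pd n00.
apply: cohom_trans de _.
have [ab|ab] := eqVneq alpha beta; last first.
  by apply: cohom_zero; apply: normalized_zero_off_diag.
have [[a aE]|na] := pselect (exists a : int, alpha = a%:~R); last first.
  apply: cohom_zero; apply: normalized_zero_of_d2 => // i ia.
  by case: na; exists i.
have a0 : alpha != 0 by apply/eqP => a0; apply: n00; rewrite -ab.
have [f [pf nf ef fa]] := normalized_kill_diag aE ab a0 pe ne.
apply: cohom_trans ef _; apply: cohom_zero.
by apply: normalized_zero_of_d2 => // i; rewrite aE => /intr_inj ->.
Qed.

(** * Spanning classes at the exceptional pairs *)

Definition spans k (E : 'I_k -> int -> int -> C) d :=
  exists c : 'I_k -> C, cohom d (fun n i => \sum_(j < k) c j * E j n i).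

Lemma spans_cohom k (E : 'I_k -> int -> int -> C) d e :
  cohom d e -> spans E e -> spans E d.
Proof. by move=> de [c ec]; exists c; exact: cohom_trans ec. Qed.

Lemma spans_lin k (E : 'I_k -> int -> int -> C) (t : C) d1 d2 :
  spans E d1 -> spans E d2 -> spans E (fun n i => d1 n i + t * d2 n i).
Proof.
move=> [c1 h1] [c2 h2]; exists (fun j => c1 j + t * c2 j).
have [w bw h] := cohom_lin t h1 h2; exists w => // n i.
rewrite h mulr_sumr -big_split; congr (_ + _); apply: eq_bigr => j _ /=; ring.
Qed.

Lemma spans_sub k (E : 'I_k -> int -> int -> C) (t : C) d e :
  spans E (fun n i => d n i + t * e n i) -> spans E e -> spans E d.
Proof.
move=> h1 h2; have [c [w bw hw]] := spans_lin (- t) h1 h2.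
by exists c, w => // n i; rewrite -hw; ring.
Qed.

Lemma spans_base k (E : 'I_k -> int -> int -> C) j : spans E (E j).
Proof.
exists (fun l => (l == j)%:R); exists (fun=> 0); first exact: bbelow0.
move=> n i; rewrite (bigD1 j) //= eqxx mul1r big1 => [|l /negPf ->].
  by rewrite /cob /lact; ring.
by rewrite mul0r.
Qed.

Lemma spans0 k (E : 'I_k -> int -> int -> C) d :
  cohom d (fun _ _ => 0) -> spans E d.
Proof.
move=> [w bw h]; exists (fun=> 0); exists w => // n i.
by rewrite h big1 // => j _; rewrite mul0r.
Qed.

(** After normalization the single scalar [d 2 0] decides whether a cocycle vanishes, so any
    nontrivial class spans. *)
Lemma spans_one d e : alpha = 0 -> beta != 0 -> pcocycle d -> pcocycle e ->
    ~ cohom e (fun _ _ => 0) ->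
  spans (fun _ : 'I_1 => e) d.
Proof.
move=> a0 b0 pd pe e0.
have n00 : ~ (alpha = 0 /\ beta = 0) by move=> [_ /eqP]; rewrite (negPf b0).
have [d' [pd' nd' dd']] := normalize pd n00.
have [e' [pe' ne' ee']] := normalize pe n00.
have zero f : pcocycle f -> normalized f -> f 2 0 = 0 -> spans (fun _ : 'I_1 => e) f
    /\ cohom f (fun _ _ => 0).
  move=> pf nf f0; suff h : cohom f (fun _ _ => 0) by split=> //; exact: spans0.
  apply: cohom_zero; apply: normalized_zero_of_d2 => //.
    by move=> [_ /eqP]; rewrite (negPf b0).
  by move=> i; rewrite a0 => /eqP; rewrite intr_eq0 => /eqP ->.
have p0 : e' 2 0 != 0.
  by apply/eqP => p0; apply: e0; apply: cohom_trans ee' _; have [] := zero _ pe' ne' p0.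
have se' : spans (fun _ : 'I_1 => e) e'.
  have [w bw h] := ee'.
  apply: (spans_cohom (cohom_cob 1 e' bw)).
  have [c [v bv hv]] := spans_base (fun _ : 'I_1 => e) ord0.
  by exists c, v => // n i; rewrite -hv h mul1r.
apply: spans_cohom dd' _.
apply: (spans_sub (t := - (d' 2 0 / e' 2 0)) _ se').
apply: (zero _ _ _ _).1.
- exact: pcocycle_lin.
- exact: normalized_lin.
- by rewrite mulNr divfK ?subrr.
Qed.

(* The cochains [L_n |-> f n v_0 (x) v_n] and [L_n |-> f n v_n (x) v_0]. *)
Definition colr (f : int -> C) n i : C := if i == 0 then f n else 0.
Definition coll (f : int -> C) n i : C := if i == n then f n else 0.

Definition fsup w := exists N : nat, forall i, N%:Z < `|i| -> w i = 0.

Lemma fsup_bbelow w : fsup w -> bbelow w.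
Proof. by move=> [N h]; exists (- N%:Z) => i hi; apply: h; lia. Qed.

Lemma fsup_lin (t : C) w1 w2 :
  fsup w1 -> fsup w2 -> fsup (fun i => w1 i + t * w2 i).
Proof.
move=> [N1 h1] [N2 h2]; exists (N1 + N2)%N => i hi.
by rewrite h1 ?h2 ?mulr0 ?addr0 //; lia.
Qed.

Lemma fsup_colr f n : fsup (colr f n).
Proof. by exists 0%N => i hi; rewrite /colr ifF //; lia. Qed.

Lemma fsup_coll f n : fsup (coll f n).
Proof. by exists (absz n) => i hi; rewrite /coll ifF //; lia. Qed.

(** For [alpha = 0] the vector [v_0] is invariant; the hypothesis on [f] is the cocycle identity of
    [L_n |-> f n v_n] in [F_beta]. *)
Lemma cocycle_colr f : alpha = 0 ->
    (forall m n, (m - n)%:~R * f (m + n)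
       = (m%:~R + beta * n%:~R) * f m - (n%:~R + beta * m%:~R) * f n) ->
  cocycle (colr f).
Proof.
move=> a0 hf m n i; rewrite /lact /colr a0 !subr_eq0.
have [->|i0] := eqVneq i 0.
  rewrite hf !sub0r; case: eqVneq => [<-|_]; case: eqVneq => [<-|_]; ring.
case: eqVneq => [->|_]; case: eqVneq => [->|_]; rewrite ?subrr; ring.
Qed.

Lemma cocycle_coll f : beta = 0 ->
    (forall m n, (m - n)%:~R * f (m + n)
       = (m%:~R + alpha * n%:~R) * f m - (n%:~R + alpha * m%:~R) * f n) ->
  cocycle (coll f).
Proof.
move=> b0 hf m n i; rewrite /lact /coll b0.
rewrite (_ : (i - m == n) = (i == m + n)); last by lia.
rewrite (_ : (i - n == m) = (i == m + n)); last by lia.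
have [->|_] := eqVneq i (m + n).
  rewrite hf (_ : m + n - m = n) 1?(_ : m + n - n = m); try lia.
  case: eqVneq => [e|_]; case: eqVneq => [e'|_].
  - have -> : m = 0 by lia.
    have -> : n = 0 by lia.
    ring.
  - have -> : m = 0 by lia.
    ring.
  - have -> : n = 0 by lia.
    ring.
  - ring.
case: eqVneq => [->|_]; case: eqVneq => [->|_]; ring.
Qed.

Lemma pcocycle_fsup d : cocycle d -> (forall n, fsup (d n)) -> pcocycle d.
Proof. by move=> h hs; split=> // n; exact: fsup_bbelow. Qed.

(** Four scalars separate a cocycle from a trivial one: [d 0 0], [d 1 0], [d (-1) (-1)] and [d 2 0].
    They are cleared in this order by [E 0], [E 3], [G] and [K], each of which respects the
    conditions already reached. *)
Lemma spans_four (E : 'I_4 -> int -> int -> C) d : alpha = 0 -> beta = 0 ->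
    (E 0 = coll (fun=> 1)) -> (E 1 = coll (fun n => n%:~R)) ->
    (E 2 = colr (fun=> 1)) -> (E 3 = colr (fun n => n%:~R)) ->
  pcocycle d -> spans E d.
Proof.
move=> a0 b0 E0 E1 E2 E3 pd.
have pE0 : pcocycle (E 0).
  rewrite E0; apply: pcocycle_fsup => [|n]; last exact: fsup_coll.
  by apply: cocycle_coll => // m n; rewrite a0; ring.
have pE1 : pcocycle (E 1).
  rewrite E1; apply: pcocycle_fsup => [|n]; last exact: fsup_coll.
  by apply: cocycle_coll => // m n; rewrite a0; ring.
have pE2 : pcocycle (E 2).
  rewrite E2; apply: pcocycle_fsup => [|n]; last exact: fsup_colr.
  by apply: cocycle_colr => // m n; rewrite b0; ring.
have pE3 : pcocycle (E 3).
  rewrite E3; apply: pcocycle_fsup => [|n]; last exact: fsup_colr.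
  by apply: cocycle_colr => // m n; rewrite b0; ring.
have sE j : spans E (E j) by exact: spans_base.
(* The coboundary of the half-infinite sum of [1/i] is a difference of step functions. *)
pose W i : C := if 0 < i then i%:~R^-1 else 0.
have bW : bbelow W by exists 0 => i i0; rewrite /W ifF //; lia.
pose H i : C := if 0 < i then 1 else 0.
have mulW i : i%:~R * W i = H i.
  rewrite /W /H; case: ifP => [i0|_]; last by rewrite mulr0.
  by rewrite mulfV // intr_eq0; lia.
have cobW n i : cob W n i = H i - H (i - n).
  by rewrite -!mulW /cob /lact a0 b0; ring.
(* [G] is cohomologous to [E 1] but vanishes on [L_0] and [L_1], so it acts on [d (-1)] alone among
   the normalization conditions. *)
pose G n i := E 1 n i + (-1) * cob W n i.
have pG : pcocycle G by apply: pcocycle_lin => //; exact: pcocycle_cob.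
have sG : spans E G.
  have [c [w bw h]] := sE 1; exists c, (fun i => w i + (-1) * W i).
    exact: bbelow_lin.
  by move=> n i; rewrite /G h /cob lact_lin; ring.
have GE n i : G n i = coll (fun n => n%:~R) n i - H i + H (i - n).
  by rewrite /G E1 cobW; ring.
have G0 i : G 0 i = 0.
  by rewrite GE subr0 /coll; case: ifP => _; ring.
have G1 i : G 1 i = 0.
  rewrite GE /coll /H; case: eqVneq => [->|i1]; first by rewrite subrr ltxx; ring.
  by rewrite (_ : (0 < i - 1) = (0 < i)); [ring | lia].
have Gm1 : G (-1) (-1) = -1 by rewrite GE /coll /H /=; ring.
(* The coefficients are chosen to make [K] normalized with [K 2 0] nonzero. *)
pose K n i := E 2 n i + (-1) * E 3 n i + (-1) * E 0 n i + 1 * E 1 n i + (-2) * G n i.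
have pK : pcocycle K.
  exact: (pcocycle_lin _ (pcocycle_lin _ (pcocycle_lin _ (pcocycle_lin _ pE2 pE3) pE0) pE1) pG).
have sK : spans E K.
  exact: (spans_lin _ (spans_lin _ (spans_lin _ (spans_lin _ (sE 2) (sE 3)) (sE 0)) (sE 1)) sG).
have K2 : K 2 0 = -1.
  by rewrite /K GE E0 E1 E2 E3 /coll /colr /H /=; ring.
have nK : normalized K.
  apply: normalized_of_zero => // [i|i|i /eqP]; rewrite /K ?G0 ?G1 E0 E1 E2 E3 /coll /colr.
  - by case: eqVneq => _; ring.
  - by case: eqVneq => [->|_]; case: eqVneq => _; ring.
  rewrite b0 intr_eq0 => /eqP i1; have -> : i = -1 by lia.
  by rewrite Gm1 /=; ring.
apply: (spans_sub (t := - d 0 0) _ (sE 0)).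
set e1 := (fun n i => _).
have pe1 : pcocycle e1 by exact: pcocycle_lin.
have e10 i : e1 0 i = 0.
  rewrite /e1 E0 /coll; case: eqVneq => [->|i0]; first by ring.
  rewrite mulr0 addr0; apply/eqP/negPn/negP => di.
  by have [_ _ iz] := invariant_supp (pd.2 0) (invariant0 pd) di; rewrite iz eqxx in i0.
have [w bw wE] := L1_reduce pe1.
apply: spans_cohom (cohom_cob (-1) e1 bw) _.
set e2 := (fun n i => _).
have pe2 : pcocycle e2 by apply: pcocycle_lin => //; exact: pcocycle_cob.
have e20 i : e2 0 i = 0.
  by rewrite /e2 e10 /cob /lact !subr0; ring.
have e21 i : i != 0 -> e2 1 i = 0.
  by move=> i0; rewrite /e2 wE ?b0 ?intr_eq0 //; ring.
clearbody e2; apply: (spans_sub (t := - e2 1 0) _ (sE 3)).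
set e3 := (fun n i => _).
have pe3 : pcocycle e3 by exact: pcocycle_lin.
have e30 i : e3 0 i = 0.
  by rewrite /e3 e20 E3 /colr; case: eqVneq => _; ring.
have e31 i : e3 1 i = 0.
  rewrite /e3 E3 /colr; case: eqVneq => [->|i0]; first by ring.
  by rewrite e21 //; ring.
clearbody e3; apply: (spans_sub (t := e3 (-1) (-1)) _ sG).
set e4 := (fun n i => _).
have pe4 : pcocycle e4 by exact: pcocycle_lin.
have ne4 : normalized e4.
  apply: normalized_of_zero => // [i|i|i /eqP]; rewrite /e4 ?e30 ?e31 ?G0 ?G1; try ring.
  rewrite b0 intr_eq0 => /eqP i1; have -> : i = -1 by lia.
  by rewrite Gm1; ring.
clearbody e4; apply: (spans_sub (t := e4 2 0) _ sK).
apply: spans0; apply: cohom_zero; apply: normalized_zero_of_d2.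
- exact: pcocycle_lin.
- exact: normalized_lin.
- by move=> [+ _]; apply/eqP; rewrite a0 eq_sym pnatr_eq0.
- by move=> i; rewrite a0 => /eqP; rewrite intr_eq0 => /eqP ->; rewrite K2; ring.
Qed.

(* At [i = 0] only [w 0] and [w (- m)] contribute to [cob w m], and the latter
   vanishes for large [m]. *)
Lemma cob_colr0 f : alpha = 0 -> cohom (colr f) (fun _ _ => 0) ->
  exists (N : int) (y : C), forall m, N < m -> f m = m%:~R * (beta * y).
Proof.
move=> a0 [w' [N hN] h]; exists (- N), (- w' 0) => m Nm.
have := h m 0; rewrite /colr eqxx => ->.
by rewrite /cob /lact sub0r (hN (- m)) ?a0; [ring | lia].
Qed.

(** A primitive would make [n^2] proportional to [n] for all large [n]; two consecutive values
    refute this. *)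
Lemma not_cohom_colr2 : alpha = 0 -> ~ cohom (colr (fun n => n%:~R ^+ 2)) (fun _ _ => 0).
Proof.
move=> a0 /(cob_colr0 a0)[N [y h]].
pose m : int := `|N| + 1.
have [h1 h2] : N < m /\ N < m + 1 by rewrite /m; lia.
have eqm (n : int) : N < n -> 0 < n -> n%:~R = beta * y.
  move=> Nn n0; have n0' : n%:~R != 0 :> C by rewrite intr_eq0; lia.
  by apply: (mulfI n0'); rewrite -h // expr2.
have : m%:~R = (m + 1)%:~R :> C by rewrite !eqm // /m; lia.
by move/intr_inj; lia.
Qed.

Lemma not_cohom_colr3 : alpha = 0 -> ~ cohom (colr (fun n => n%:~R ^+ 3)) (fun _ _ => 0).
Proof.
move=> a0 /(cob_colr0 a0)[N [y h]].
pose m : int := `|N| + 1.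
have eqm (n : int) : N < n -> 0 < n -> (n * n)%:~R = beta * y.
  move=> Nn n0; have n0' : n%:~R != 0 :> C by rewrite intr_eq0; lia.
  by apply: (mulfI n0'); rewrite -h //; ring.
have : (m * m)%:~R = ((m + 1) * (m + 1))%:~R :> C by rewrite !eqm // /m; lia.
by move/intr_inj; rewrite /m; nia.
Qed.

(** * Independence modulo bounded-below coboundaries *)

Definition independent k (E : 'I_k -> int -> int -> C) :=
  forall (c : 'I_k -> C) w, bbelow w ->
    (forall n i, \sum_(j < k) c j * E j n i = cob w n i) -> forall j, c j = 0.

Lemma independent_one e : ~ cohom e (fun _ _ => 0) -> independent (fun _ : 'I_1 => e).
Proof.
move=> ne c w bw h j; rewrite ord1; apply/eqP/negPn/negP => c0; apply: ne.
exists (fun i => 0 + (c ord0)^-1 * w i).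
  exact: (bbelow_lin _ bbelow0 bw).
move=> n i; rewrite add0r /cob lact_lin; have := h n i.
rewrite big_ord1 /cob => <-; rewrite mulrA mulVf // mul1r /lact; ring.
Qed.

(** For large [m] the coefficient at [i = 0] sees only [E 2] and [E 3]; for very negative [m] the
    one at [i = m] sees only [E 0] and [E 1]. Each leaves an affine function of [m] with two
    zeros. *)
Lemma independent_four (E : 'I_4 -> int -> int -> C) : alpha = 0 -> beta = 0 ->
    (E 0 = coll (fun=> 1)) -> (E 1 = coll (fun n => n%:~R)) ->
    (E 2 = colr (fun=> 1)) -> (E 3 = colr (fun n => n%:~R)) ->
  independent E.
Proof.
move=> a0 b0 E0 E1 E2 E3 c w [N hN] h.
have h' n i : c 0 * coll (fun=> 1) n i + c 1 * coll (fun n => n%:~R) n i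
    + c 2 * colr (fun=> 1) n i + c 3 * colr (fun n => n%:~R) n i = cob w n i.
  rewrite -h -E0 -E1 -E2 -E3 !big_ord_recl big_ord0 !addrA addr0.
  by do ![congr (_ + _)]; congr (c _ * E _ _ _); apply/val_inj.
have two (x y : C) (m : int) : x + y * m%:~R = 0 -> x + y * (m + 1)%:~R = 0 -> x = 0 /\ y = 0.
  move=> h1 h2; have y0 : y = 0.
    by apply: (eq_by (etrans h2 (esym h1))); rewrite intrD; ring.
  by move: h1; rewrite y0 mul0r addr0.
pose M : int := `|N| + 1.
have r m : M <= m -> c 2 + c 3 * m%:~R = 0.
  move=> Mm; apply: (eq_by (h' m 0)).
  rewrite /coll /colr eqxx (_ : (0 == m) = false); last by lia.
  by rewrite /cob /lact (hN (0 - m)) ?a0 ?b0; [ring | lia].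
have l m : m <= - M -> c 0 + c 1 * m%:~R = 0.
  move=> Mm; apply: (eq_by (h' m m)).
  rewrite /coll /colr eqxx (_ : (m == 0) = false); last by lia.
  by rewrite /cob /lact (hN m) ?a0 ?subrr; [ring | lia].
have [c2 c3] := two _ _ _ (r M (lexx _)) (r (M + 1) ltac:(lia)).
have [c0 c1] := two _ _ _ (l (- M - 1) ltac:(lia)) (l (- M - 1 + 1) ltac:(lia)).
by case=> [[|[|[|[|//]]]] hj];
  [rewrite -c0 | rewrite -c1 | rewrite -c2 | rewrite -c3]; congr c; apply/val_inj.
Qed.

(** * Tails of primitives whose coboundaries are finite *)

Lemma eventually_neq (g : C) : exists N : nat, forall i, N%:Z < i -> i%:~R != g.
Proof.
have [[a ->]|na] := pselect (exists a : int, g = a%:~R); last first.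
  by exists 0%N => i _; apply/eqP => ig; apply: na; exists i.
by exists (absz a) => i hi; rewrite eqr_int; lia.
Qed.

(** Far to the right the coboundary vanishes, so [w] obeys the equations of an invariant, with a
    bound depending on [m]. *)
Lemma tail_recurrence w : (forall n, fsup (cob w n)) -> forall m,
  exists N : nat, forall i, N%:Z < i ->
    (i%:~R - beta * m%:~R) * w i = ((i - m)%:~R + alpha * m%:~R) * w (i - m).
Proof.
move=> fw m; have [N h] := fw m; exists N => i Ni.
by apply: (eq_by (h i _)); [lia | rewrite /cob /lact; ring].
Qed.

(** A nonzero [w i] far out is tested twice. [L_1] against [L_{-1}] gives
    [(alpha - beta) (1 - alpha - beta) = 0], hence [alpha = beta]; [L_1] applied twice against [L_2]
    then gives [2 alpha (2 alpha - 1) (alpha - 1) = 0]. *)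
Lemma tail_zero w : bbelow w -> (forall n, fsup (cob w n)) ->
    alpha + beta != 1 -> ~ (alpha = 0 /\ beta = 0) -> ~ (alpha = 1 /\ beta = 1) ->
  fsup w.
Proof.
move=> [M hM] fw ab1 n00 n11.
have [N1 t1] := tail_recurrence fw 1.
have [Nm tm] := tail_recurrence fw (-1).
have [N2 t2] := tail_recurrence fw 2.
have [Na na] := eventually_neq (alpha - 1).
have [Nb nb] := eventually_neq (beta - 2).
exists (absz M + N1 + Nm + N2 + Na + Nb)%N => i Ni.
have [iM|Mi] := ltP i M; first exact: hM.
apply/eqP/negPn/negP => wi.
have T1 : ((i + 1)%:~R - beta) * w (i + 1) = (i%:~R + alpha) * w i.
  have E := t1 (i + 1) ltac:(lia); rewrite addrK in E.
  by apply: (eq_by E); ring.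
have Tm : (i%:~R + beta) * w i = ((i + 1)%:~R - alpha) * w (i + 1).
  have E := tm i ltac:(lia); rewrite opprK in E.
  by apply: (eq_by E); ring.
have T1' : ((i + 2)%:~R - beta) * w (i + 2) = ((i + 1)%:~R + alpha) * w (i + 1).
  have E := t1 (i + 2) ltac:(lia); rewrite (_ : i + 2 - 1 = i + 1) in E; last by lia.
  by apply: (eq_by E); ring.
have T2 : ((i + 2)%:~R - beta * 2) * w (i + 2) = (i%:~R + alpha * 2) * w i.
  have E := t2 (i + 2) ltac:(lia); rewrite addrK in E.
  by apply: (eq_by E); ring.
have ab : alpha = beta.
  have : (alpha - beta) * (1 - (alpha + beta)) * w i = 0.
    transitivity (((i + 1)%:~R - alpha) * ((i%:~R + alpha) * w i)
      - ((i + 1)%:~R - beta) * ((i%:~R + beta) * w i)); first by ring.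
    by rewrite -T1 Tm; ring.
  move/eqP; rewrite !mulf_eq0 (negPf wi) orbF !subr_eq0 [1 == _]eq_sym (negPf ab1) orbF.
  by move/eqP.
rewrite -ab in T1 T1' T2 ab1 n00 n11.
have : (2 * alpha) * ((alpha + alpha) - 1) * (alpha - 1) * w i = 0.
  transitivity (((i + 2)%:~R - alpha) * (((i + 1)%:~R - alpha) * ((i%:~R + alpha * 2) * w i))
    - ((i + 2)%:~R - alpha * 2) * (((i + 1)%:~R + alpha) * ((i%:~R + alpha) * w i))).
    by ring.
  rewrite -T2 -T1.
  transitivity (((i + 2)%:~R - alpha * 2) * ((i + 1)%:~R - alpha) *
     (((i + 2)%:~R - alpha) * w (i + 2) - ((i + 1)%:~R + alpha) * w (i + 1))).
    by ring.
  by rewrite T1' subrr mulr0.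
move/eqP; rewrite !mulf_eq0 (negPf wi) orbF pnatr_eq0 /= subr_eq0 (negPf ab1) orbF.
rewrite subr_eq0 => /orP[] /eqP a01; first exact: n00.
exact: n11.
Qed.

Definition half (tau : int -> C) i : C := if 0 < i then tau i else 0.

Lemma half_pos tau i : 0 < i -> half tau i = tau i.
Proof. by rewrite /half => ->. Qed.

(** The equations are required only between positive indices, since [1/i] does not satisfy them
    across [i = 0]. *)
Definition tail_invariant (tau : int -> C) :=
  (forall i, 0 < i -> tau i != 0) /\
  (forall m i, 0 < i -> 0 < i - m -> lact m 0 tau i = 0).

Lemma bbelow_half tau : bbelow (half tau).
Proof. by exists 0 => i i0; rewrite /half ifF //; lia. Qed.

(** The cut is felt only when [i] and [i - n] lie on different sides of it, hence only for
    [|i| <= |n|]. *)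
Lemma fsup_cob_half tau : tail_invariant tau -> forall n, fsup (cob (half tau) n).
Proof.
move=> [_ h] n; exists (absz n) => i ni; rewrite /cob /lact /half.
have [i0|i0] := ltP 0 i.
  rewrite ifT; last by lia.
  by apply: (eq_by (h n i i0 _)); [lia | rewrite /lact; ring].
by rewrite ifF; [ring | lia].
Qed.

(** Far out, [w] and [tau] obey the same [L_1] recurrence with nonzero leading coefficient, so one
    value fixes the ratio. *)
Lemma tail_multiple tau w : tail_invariant tau ->
    bbelow w -> (forall n, fsup (cob w n)) ->
  exists c : C, fsup (fun i => w i + (- c) * half tau i).
Proof.
move=> [t0 ht] [M hM] fw.
have [N1 t1] := tail_recurrence fw 1.
have [Nb nb] := eventually_neq beta.
pose N := (absz M + N1 + Nb)%N.
exists (w N.+1 / tau N.+1), N.+1 => i Ni.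
have [iM|Mi] := ltP i M.
  by rewrite hM // /half ifF ?mulr0 ?addr0 //; lia.
have [k ->] : exists k : nat, i = N.+1%:Z + k by exists (absz (i - N.+1%:Z)%R); lia.
rewrite half_pos; last by lia.
apply/eqP; rewrite mulNr subr_eq0; apply/eqP.
elim: k => [|k IH]; first by rewrite addr0 divfK ?t0.
set j := N.+1%:Z + k.+1.
have jE : j - 1 = N.+1%:Z + k by rewrite /j; lia.
have jb : j%:~R - beta != 0 by rewrite subr_eq0; apply: nb; rewrite /j /N; lia.
apply: (mulfI jb).
have E := t1 j ltac:(rewrite /j /N; lia); rewrite jE IH in E.
have T : (j%:~R - beta) * tau j = ((N.+1%:Z + k)%:~R + alpha) * tau (N.+1%:Z + k).
  rewrite -jE; apply: (eq_by (ht 1 j _ _)); rewrite ?/j; try lia.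
  by rewrite /lact; ring.
rewrite mulrCA T; move: E; move: (w _ / _) => c E.
by apply: (eq_by E); ring.
Qed.

(** In the enlarged module the tail class is a coboundary, so independence of [E] gives [c = 0].
    Then [w - t * half tau] is an invariant, thus zero off [i = 0], whereas beyond the support of
    [w] it equals [- t * tau]. *)
Lemma independent_half k (E : 'I_k -> int -> int -> C) tau (c : 'I_k -> C) (t : C) w :
    independent E -> tail_invariant tau -> fsup w ->
    (forall n i, \sum_(j < k) c j * E j n i + t * cob (half tau) n i = cob w n i) ->
  t = 0 /\ forall j, c j = 0.
Proof.
move=> iE [t0 _] fw h; pose u i := w i + (- t) * half tau i.
have bu : bbelow u by apply: bbelow_lin; [exact: fsup_bbelow | exact: bbelow_half].
have hu n i : \sum_(j < k) c j * E j n i = cob u n i.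
  by apply: (eq_by (h n i)); rewrite /u /cob lact_lin; ring.
have c0 := iE _ _ bu hu; split=> //.
have [N hN] := fw; have uN : u N.+1 = 0.
  apply/eqP/negPn/negP => /(invariant_supp bu)[|_ _ //] m i.
  by rewrite -[LHS]hu big1 // => j _; rewrite c0 mul0r.
move/eqP: uN; rewrite /u hN; last by lia.
rewrite add0r half_pos; last by lia.
by rewrite mulf_eq0 (negPf (t0 _ _)) ?orbF ?oppr_eq0 => [/eqP|]; last by lia.
Qed.
End Degree0.

(** * From degree zero to the whole tensor product *)

Section Tensor.
Variables (C : numFieldType) (alpha beta : C).
Implicit Types (w : int -> C) (d : int -> int -> C) (m n i a b : int).

Definition emb d n a b : C := if a + b == n then d n a else 0.

Lemma finsupp_emb d n : fsup (d n) -> finsupp (emb d n).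
Proof.
move=> [N h]; exists (N + absz n)%N => a b hab.
by rewrite /emb; case: eqP => // abn; apply: h; lia.
Qed.

Lemma is_der_emb d : cocycle alpha beta d -> (forall n, fsup (d n)) ->
  is_der alpha beta (emb d).
Proof.
move=> hd fd; split=> [n|m n a b]; first exact: finsupp_emb.
rewrite /tact /emb.
rewrite (_ : (a - m + b == n) = (a + b == m + n)); last by lia.
rewrite (_ : (a + (b - m) == n) = (a + b == m + n)); last by lia.
rewrite (_ : (a - n + b == m) = (a + b == m + n)); last by lia.
rewrite (_ : (a + (b - n) == m) = (a + b == m + n)); last by lia.
case: eqP => [abE|_]; last by ring.
have -> : b = m + n - a by lia.
by rewrite hd /lact; ring.
Qed.

(** [L_m] raises [a + b] by [m], so the components of [D n] on [a + b = n] satisfy the cocycle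
    identity among themselves. *)
Lemma is_der_diag D : is_der alpha beta D ->
  cocycle alpha beta (fun n i => D n i (n - i)) /\ forall n, fsup (fun i => D n i (n - i)).
Proof.
move=> [fD hD]; split=> [m n i|n]; last first.
  by have [N h] := fD n; exists N => i hi; apply: h; left.
rewrite hD /tact /lact.
have -> : n - (i - m) = m + n - i by lia.
have -> : m - (i - n) = m + n - i by lia.
have -> : m + n - i - m = n - i by lia.
have -> : m + n - i - n = m - i by lia.
by ring.
Qed.

(* For [a + b != n], dividing by the eigenvalue of L_0 gives a
   primitive: [L_n (D_0) = L_0 (D_n) + n D_n = (n - a - b) D_n] at [(a, b)]. *)
Lemma is_der_off_diag D : is_der alpha beta D ->
  exists2 v : int -> int -> C, finsupp v & forall n a b,
    inner_der alpha beta v n a b = if a + b == n then 0 else D n a b.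
Proof.
move=> [fD hD].
exists (fun a b => if a + b == 0 then 0 else - D 0 a b / (a + b)%:~R).
  have [N h] := fD 0; exists N => a b hab.
  by rewrite h // oppr0 mul0r; case: ifP.
move=> n a b; rewrite /inner_der /tact.
rewrite (_ : (a - n + b == 0) = (a + b == n)); last by lia.
rewrite (_ : (a + (b - n) == 0) = (a + b == n)); last by lia.
case: eqP => [_|abn]; first by ring.
have -> : a - n + b = a + b - n by lia.
have -> : a + (b - n) = a + b - n by lia.
have k0 : (a + b - n)%:~R != 0 :> C by rewrite intr_eq0; lia.
apply: (mulfI k0); have := hD n 0 a b; rewrite /tact addr0 !subr0 => E.
move: k0 E; move: (D 0 (a - n) b) (D 0 a (b - n)) (D n a b) => x y z k0 E.
transitivity (((a - n)%:~R + alpha * n%:~R) * x + ((b - n)%:~R + beta * n%:~R) * y).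
  by move: (_%:~R) k0 => k k0; field.
by apply: (eq_by E); ring.
Qed.

Lemma H1_dim_of_degree0 k (E : 'I_k -> int -> int -> C) :
    (forall j, cocycle alpha beta (E j)) -> (forall j n, fsup (E j n)) ->
    (forall d, cocycle alpha beta d -> (forall n, fsup (d n)) ->
      exists (c : 'I_k -> C) w, fsup w /\
        forall n i, d n i = \sum_(j < k) c j * E j n i + cob alpha beta w n i) ->
    (forall (c : 'I_k -> C) w, fsup w ->
      (forall n i, \sum_(j < k) c j * E j n i = cob alpha beta w n i) ->
      forall j, c j = 0) ->
  H1_dim_eq alpha beta k.
Proof.
move=> cE fE sE iE; exists (fun j => emb (E j)).
split; [|split] => [j|D dD|c v fv h].
- exact: is_der_emb.
- have [cD fsD] := is_der_diag dD.
  have [c [w [fw hw]]] := sE _ cD fsD.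
  have [v fv hv] := is_der_off_diag dD.
  (* The primitive adds the off-diagonal one and the degree-zero one, placed on [a + b = 0]. *)
  exists c, (fun a b => v a b + emb (fun _ => w) 0 a b); split.
    have [N1 h1] := fv; have [N2 h2] := @finsupp_emb (fun=> w) 0 fw.
    exists (N1 + N2)%N => a b hab.
    by rewrite h1 ?h2 ?addr0 //; lia.
  move=> n a b; set s := \sum_(j < k) _.
  transitivity (s + (inner_der alpha beta v n a b
      + inner_der alpha beta (emb (fun=> w) 0) n a b)); last first.
    by rewrite /inner_der /tact; ring.
  rewrite hv {}/s /inner_der /tact /emb.
  rewrite (_ : (a - n + b == 0) = (a + b == n)); last by lia.
  rewrite (_ : (a + (b - n) == 0) = (a + b == n)); last by lia.
  case: eqP => [abn|_].
    have -> : b = n - a by lia.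
    by rewrite hw /cob /lact; ring.
  by rewrite big1 => [|j _]; [ring | rewrite mulr0].
- apply: (iE c (fun i => v i (- i))).
    by have [N hN] := fv; exists N => i hi; apply: hN; left.
  move=> n i; have := h n i (n - i).
  under eq_bigr => j _ do rewrite /emb addrC subrK eqxx.
  move=> ->; rewrite /inner_der /tact /cob /lact.
  have -> : - (i - n) = n - i by lia.
  have -> : n - i - n = - i by lia.
  by ring.
Qed.

Lemma fsup_sum k (F : 'I_k -> int -> C) :
  (forall j, fsup (F j)) -> fsup (fun i => \sum_(j < k) F j i).
Proof.
move=> /boolp.choice[N hN].
exists (\sum_(j < k) N j)%N => i hi; rewrite big1 // => j _; apply: hN.
by apply: le_lt_trans hi; rewrite lez_nat (bigD1 j) //= leq_addr.
Qed.

Lemma fsup_cob_rest k (E : 'I_k -> int -> int -> C) (c : 'I_k -> C) d w :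
    (forall n, fsup (d n)) -> (forall j n, fsup (E j n)) ->
    (forall n i, d n i = \sum_(j < k) c j * E j n i + cob alpha beta w n i) ->
  forall n, fsup (cob alpha beta w n).
Proof.
move=> fd fE h n.
have fS : fsup (fun i => \sum_(j < k) c j * E j n i).
  apply: fsup_sum => j; have [N hN] := fE j n.
  by exists N => i /hN ->; rewrite mulr0.
have [N hN] := fsup_lin (-1) (fd n) fS.
by exists N => i hi; rewrite -(hN i hi) h; ring.
Qed.

(** The primitive found in the enlarged module is finite by [tail_zero], so both cohomologies have
    the same basis. *)
Lemma H1_dim_no_tail k (E : 'I_k -> int -> int -> C) :
    (forall j, cocycle alpha beta (E j)) -> (forall j n, fsup (E j n)) ->
    (forall d, pcocycle alpha beta d -> spans alpha beta E d) ->
    independent alpha beta E ->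
    alpha + beta != 1 -> ~ (alpha = 0 /\ beta = 0) -> ~ (alpha = 1 /\ beta = 1) ->
  H1_dim_eq alpha beta k.
Proof.
move=> cE fE sE iE ab1 n00 n11.
apply: (H1_dim_of_degree0 cE fE) => [d cd fd|c w fw]; last first.
  by apply: iE; exact: fsup_bbelow.
have [c [w bw hw]] := sE d (pcocycle_fsup cd fd).
exists c, w; split=> //; apply: (tail_zero bw _ ab1 n00 n11).
exact: fsup_cob_rest fd fE hw.
Qed.

(** The coboundary of [half tau] is finite while its primitive is not: it is the extra class, stored
    at index 0 of [F]. *)
Lemma H1_dim_tail k (E : 'I_k -> int -> int -> C) (tau : int -> C) :
    (forall j, cocycle alpha beta (E j)) -> (forall j n, fsup (E j n)) ->
    (forall d, pcocycle alpha beta d -> spans alpha beta E d) ->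
    independent alpha beta E -> tail_invariant alpha beta tau ->
  H1_dim_eq alpha beta k.+1.
Proof.
move=> cE fE sE iE ht.
pose T := cob alpha beta (half tau).
pose F (j : 'I_k.+1) := if unlift ord0 j is Some l then E l else T.
have sumF (c : 'I_k.+1 -> C) n i : \sum_(j < k.+1) c j * F j n i
    = \sum_(j < k) c (lift ord0 j) * E j n i + c ord0 * T n i.
  rewrite big_ord_recl addrC {2}/F unlift_none; congr (_ + _).
  by apply: eq_bigr => j _; rewrite /F liftK.
apply: (@H1_dim_of_degree0 _ F) => [j|j n|d cd fd|c w fw h].
- rewrite /F; case: unliftP => [l _|_]; first exact: cE.
  exact: cob_cocycle.
- rewrite /F; case: unliftP => [l _|_]; first exact: fE.
  exact: fsup_cob_half.
- have [c [w bw hw]] := sE d (pcocycle_fsup cd fd).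
  have [t ft] := tail_multiple ht bw (fsup_cob_rest fd fE hw).
  exists (fun j => if unlift ord0 j is Some l then c l else t).
  exists (fun i => w i + (- t) * half tau i); split=> // n i.
  rewrite sumF unlift_none hw /T /cob lact_lin.
  under [in RHS]eq_bigr => j _ do rewrite liftK.
  by ring.
- have h' n i : \sum_(j < k) c (lift ord0 j) * E j n i + c ord0 * T n i
      = cob alpha beta w n i by rewrite -h sumF.
  have [t0 c0] := independent_half iE ht fw h'.
  by move=> j; case: (unliftP ord0 j) => [l ->|->].
Qed.

End Tensor.

(** The flip of the two tensor factors is an isomorphism of modules. *)
Lemma H1_dim_swap (C : numFieldType) (alpha beta : C) k :
  H1_dim_eq alpha beta k -> H1_dim_eq beta alpha k.
Proof.
have fswap (f : int -> int -> C) : finsupp f -> finsupp (fun a b => f b a).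
  by move=> [N h]; exists N => a b hab; apply: h; case: hab; [right | left].
have dswap (x y : C) d : is_der x y d -> is_der y x (fun n a b => d n b a).
  by move=> [fd hd]; split=> [n|m n a b]; [exact: fswap | rewrite hd /tact; ring].
move=> [ds [hds [hs hi]]]; exists (fun j n a b => ds j n b a).
split; [|split] => [j|D /dswap /hs [c [v [fv hv]]]|c v fv h].
- exact: dswap.
- exists c, (fun a b => v b a); split; first exact: fswap.
  by move=> n a b; rewrite hv /inner_der /tact; ring.
- apply: (hi c (fun a b => v b a)); first exact: fswap.
  by move=> n a b; rewrite h /inner_der /tact; ring.
Qed.

(** * The dimension for each pair of weights *)

Section Values.
Variables (C : numFieldType) (alpha beta : C).

Lemma tail_invariant1 : alpha + beta = 1 -> tail_invariant alpha beta (fun=> 1).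
Proof.
move=> ab; split=> [i _|m i _ _]; first exact: oner_neq0.
by rewrite /lact -(addKr alpha beta) ab; ring.
Qed.

Lemma tail_invariantV : alpha = 0 -> beta = 0 ->
  tail_invariant alpha beta (fun i => i%:~R^-1).
Proof.
move=> -> ->; split=> [i i0|m i i0 im]; first by rewrite invr_eq0 intr_eq0; lia.
rewrite /lact sub0r !mul0r !addr0 rmorphN mulNr !mulfV ?intr_eq0; try lia.
by ring.
Qed.

Lemma tail_invariantX : alpha = 1 -> beta = 1 ->
  tail_invariant alpha beta (fun i => i%:~R).
Proof.
move=> -> ->; split=> [i i0|m i i0 im]; first by rewrite intr_eq0; lia.
by rewrite /lact; ring.
Qed.

Definition four (j : 'I_4) : int -> int -> C :=
  match val j with
  | 0 => coll (fun=> 1) | 1 => coll (fun n => n%:~R)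
  | 2 => colr (fun=> 1) | _ => colr (fun n => n%:~R)
  end.

Lemma H1_dim00 : alpha = 0 -> beta = 0 -> H1_dim_eq alpha beta 5.
Proof.
move=> a0 b0; apply: (@H1_dim_tail _ _ _ 4 four (fun i => i%:~R^-1)).
- case=> [[|[|[|[|//]]]] hj] /=; rewrite /four /=;
    by [apply: cocycle_coll => // m n; rewrite a0; ring
      | apply: cocycle_colr => // m n; rewrite b0; ring].
- case=> [[|[|[|[|//]]]] hj] n; rewrite /four /=;
    by [exact: fsup_coll | exact: fsup_colr].
- by move=> d; exact: spans_four.
- exact: independent_four.
- exact: tail_invariantV.
Qed.

(** Up to a scalar, the second derivative of a vector field on the circle, with values in
    1-forms. *)
Lemma cocycle_colr2 : alpha = 0 -> beta = 1 ->
  cocycle alpha beta (colr (fun n => n%:~R ^+ 2)).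
Proof. by move=> a0 b1; apply: cocycle_colr => // m n; rewrite b1; ring. Qed.

(** Up to a scalar, the third derivative, with values in quadratic differentials. *)
Lemma cocycle_colr3 : alpha = 0 -> beta = 2 ->
  cocycle alpha beta (colr (fun n => n%:~R ^+ 3)).
Proof. by move=> a0 b2; apply: cocycle_colr => // m n; rewrite b2; ring. Qed.

Lemma H1_dim01 : alpha = 0 -> beta = 1 -> H1_dim_eq alpha beta 2.
Proof.
move=> a0 b1; have cE := cocycle_colr2 a0 b1.
apply: (@H1_dim_tail _ _ _ 1 (fun=> colr (fun n => n%:~R ^+ 2)) (fun=> 1)).
- by [].
- by move=> _ n; exact: fsup_colr.
- move=> d pd; apply: spans_one => //; first by rewrite b1 oner_eq0.
    by apply: pcocycle_fsup => // n; exact: fsup_colr.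
  exact: not_cohom_colr2.
- by apply: independent_one; exact: not_cohom_colr2.
- by apply: tail_invariant1; rewrite a0 b1 add0r.
Qed.

Lemma H1_dim02 : alpha = 0 -> beta = 2 -> H1_dim_eq alpha beta 1.
Proof.
move=> a0 b2; have cE := cocycle_colr3 a0 b2.
apply: (@H1_dim_no_tail _ _ _ 1 (fun=> colr (fun n => n%:~R ^+ 3))).
- by [].
- by move=> _ n; exact: fsup_colr.
- move=> d pd; apply: spans_one => //; first by rewrite b2 pnatr_eq0.
    by apply: pcocycle_fsup => // n; exact: fsup_colr.
  exact: not_cohom_colr3.
- by apply: independent_one; exact: not_cohom_colr3.
- by rewrite a0 b2 add0r (eqr_nat C 2 1).
- by move=> [_]; apply/eqP; rewrite b2 pnatr_eq0.
- by move=> [+ _]; apply/eqP; rewrite a0 eq_sym oner_eq0.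
Qed.

Section Generic.
Hypotheses (n00 : ~ (alpha = 0 /\ beta = 0))
  (n01 : ~ (alpha = 0 /\ beta = 1)) (n10 : ~ (alpha = 1 /\ beta = 0))
  (n02 : ~ (alpha = 0 /\ beta = 2)) (n20 : ~ (alpha = 2 /\ beta = 0)).

(** The enlarged module has no cohomology here, so the empty family spans and only the tail class
    remains. *)
Lemma H1_dim_generic_tail tau :
  tail_invariant alpha beta tau -> H1_dim_eq alpha beta 1.
Proof.
apply: (@H1_dim_tail _ _ _ 0 (fun _ _ _ => 0)) => [[]|[]|d pd|c w bw h []] //.
by apply: spans0; exact: cohom_trivial.
Qed.

Lemma H1_dim_generic : alpha + beta != 1 -> ~ (alpha = 1 /\ beta = 1) ->
  H1_dim_eq alpha beta 0.
Proof.
move=> ab1 n11.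
apply: (@H1_dim_no_tail _ _ _ 0 (fun _ _ _ => 0)) => // [[]|[]|d pd|c w bw h []] //.
by apply: spans0; exact: cohom_trivial.
Qed.

End Generic.
End Values.

Unset Implicit Arguments. Set Strict Implicit.

Theorem theoremT (R : realType) (alpha beta : R[i]) :
  H1_dim_eq alpha beta
    (if (alpha == 0) && (beta == 0) then 5%N
     else if ((alpha == 0) && (beta == 1)) || ((alpha == 1) && (beta == 0)) then 2%N
     else if [|| (alpha == 0) && (beta == 2), (alpha == 2) && (beta == 0),
                 (alpha == 1) && (beta == 1)
               | [&& alpha + beta == 1, beta != 0 & beta != 1]] then 1%N
     else 0%N).
Proof.
have pairP (x y : R[i]) : reflect (alpha = x /\ beta = y) ((alpha == x) && (beta == y)).
  by apply: (iffP andP) => [[/eqP -> /eqP ->]|[-> ->]].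
case: (pairP _ _) => [[a0 b0]|n00]; first exact: H1_dim00.
case: (pairP _ _) => [[a0 b1]|n01]; first exact: H1_dim01.
case: (pairP _ _) => [[a1 b0]|n10]; first by apply: H1_dim_swap; exact: H1_dim01.
case: (pairP _ _) => [[a0 b2]|n02]; first exact: H1_dim02.
case: (pairP _ _) => [[a2 b0]|n20]; first by apply: H1_dim_swap; exact: H1_dim02.
case: (pairP _ _) => [[a1 b1]|n11] /=.
  exact: H1_dim_generic_tail (tail_invariantX a1 b1).
have [ab|ab] /= := eqVneq (alpha + beta) 1; last exact: H1_dim_generic.
rewrite ifT; first exact: H1_dim_generic_tail (tail_invariant1 ab).
(* On the line [alpha + beta = 1], [beta = 0] or [beta = 1] is the pair (1,0) or (0,1), treated
   above. *)
by apply/andP; split; apply/eqP => bE; [apply: n10 | apply: n01];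
  rewrite bE -(addrK beta alpha) ab bE ?subr0 ?subrr.
Qed.
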